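(* Let $n_u\ge 1$, let $\mathcal{Q}\subset\mathbb{R}^{n_u}$ be convex, and let $f$ be a real-valued function that is twice continuously differentiable on $\mathcal{Q}$ and whose gradient is Lipschitz continuous on $\mathcal{Q}$ with constant $L\ge 0$. Let $\mathcal{U}=\{u_0,u_1,\dots,u_{n_u}\}\subset\mathcal{Q}$ be such that $U=[\,u_1-u_0,\ \dots,\ u_{n_u}-u_0\,]\in\mathbb{R}^{n_u\times n_u}$ is nonsingular. Then the noise-free simplex gradient $g_t$ satisfies $$\|g_t-\nabla f(u_0)\|\le T_c:=\frac{L}{2}\,\Bigl\|\bigl[\,(u_1-u_0)^{\mathsf T}(u_1-u_0),\ \dots,\ (u_{n_u}-u_0)^{\mathsf T}(u_{n_u}-u_0)\,\bigr]\Bigr\|\,\|U^{-1}\|.$$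
   Context: $\|\cdot\|$ denotes the Euclidean norm of a vector (row or column), or the spectral norm of a matrix (the norm induced by the Euclidean norm). Vectors $u_j\in\mathbb{R}^{n_u}$ are column vectors and gradients are column vectors. The gradient $\nabla f$ is Lipschitz continuous on $\mathcal{Q}$ with constant $L$ if $\|\nabla f(a)-\nabla f(b)\|\le L\|a-b\|$ for all $a,b\in\mathcal{Q}$. The noise-free simplex gradient is $$g_t=(U^{-1})^{\mathsf T}\bigl[f(u_1)-f(u_0),\ \dots,\ f(u_{n_u})-f(u_0)\bigr]^{\mathsf T}.$$ *)

(* Defs.v *)
From HB Require Import structures.
From mathcomp Require Export all_boot all_order all_algebra.
From mathcomp Require Export all_classical all_reals all_analysis.

Set Implicit Arguments.
Unset Strict Implicit.
Unset Printing Implicit Defensive.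

Import Order.TTheory GRing.Theory Num.Theory.
Export numFieldNormedType.Exports.

Local Open Scope classical_set_scope.
Local Open Scope ring_scope.

(* MathComp-Analysis over an arbitrary [R : realType].  The library norm on
   matrices is the sup norm, hence the Euclidean and spectral norms below.  The
   library's differentiability and continuity are used as they are, since all
   norms on a finite-dimensional space are equivalent. *)

(* Meant for row and column vectors only (m = 1 or n = 1). *)
Definition enorm (R : realType) (m n : nat) (v : 'M[R]_(m, n)) : R :=
  Num.sqrt (\sum_i \sum_j v i j ^+ 2).

Definition spectral_norm (R : realType) (m n : nat) (A : 'M[R]_(m, n)) : R :=
  sup [set enorm (A *m x) | x in [set x : 'cV[R]_n | enorm x <= 1]].

(* [Q] need not be open, so derivatives are taken relative to [Q]: the library
   differential is applied to the trace on [Q] of the neighborhoods of [x].  Only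
   the values of [f] on [Q] matter; for [x] in the interior of [Q] these are the
   usual derivatives, and if [Q] is convex with nonempty interior the
   differential is unique at every point of [Q]. *)
Definition gradient (R : realType) (n : nat) (Q : set 'cV[R]_n)
    (f : 'cV[R]_n -> R) (x : 'cV[R]_n) : 'cV[R]_n :=
  \col_i 'd f (within Q (nbhs x)) (delta_mx i 0).

Definition hessian (R : realType) (n : nat) (Q : set 'cV[R]_n)
    (f : 'cV[R]_n -> R) (x : 'cV[R]_n) : 'M[R]_n :=
  \matrix_(i, j) 'd (gradient Q f) (within Q (nbhs x)) (delta_mx j 0) i 0.

(* Continuity of [f] and of its gradient on [Q] follows from the first two
   clauses. *)
Definition twice_continuously_differentiable_on (R : realType) (n : nat)
    (Q : set 'cV[R]_n) (f : 'cV[R]_n -> R) : Prop :=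
  [/\ forall x, Q x -> differentiable f (within Q (nbhs x)),
      forall x, Q x -> differentiable (gradient Q f) (within Q (nbhs x)) &
      {within Q, continuous (hessian Q f)}].

Definition euclidean_lipschitz_on (R : realType) (n : nat) (Q : set 'cV[R]_n)
    (L : R) (g : 'cV[R]_n -> 'cV[R]_n) : Prop :=
  forall a b, Q a -> Q b -> enorm (g a - g b) <= L * enorm (a - b).

(* For j in {0, ..., n-1} this is u_{j+1} - u_0. *)
Definition displacement (R : realType) (n : nat) (u : 'I_n.+1 -> 'cV[R]_n)
    (j : 'I_n) : 'cV[R]_n :=
  u (lift ord0 j) - u ord0.

Definition simplex_matrix (R : realType) (n : nat) (u : 'I_n.+1 -> 'cV[R]_n) :
    'M[R]_n :=
  \matrix_(i, j) displacement u j i 0.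

Definition simplex_gradient (R : realType) (n : nat) (f : 'cV[R]_n -> R)
    (u : 'I_n.+1 -> 'cV[R]_n) : 'cV[R]_n :=
  (invmx (simplex_matrix u))^T *m
    (\row_j (f (u (lift ord0 j)) - f (u ord0)))^T.

(* Main.v *)
Require Import Defs.
From mathcomp Require Import ring lra.

(** The vector [g_t - grad f (u_0)] is [U^-T e], where the [j]-th entry of [e]
    is [f (u_j) - f (u_0) - <grad f (u_0), d_j>] with [d_j = u_j - u_0]: the
    gradient at [u_0] equals [U^-T (U^T grad f (u_0))], and the entries of
    [U^T grad f (u_0)] are the numbers [<grad f (u_0), d_j>].  So [e] collects
    the remainders of the first-order expansion of [f] at [u_0].

    Each remainder is at most [L / 2 * |d_j|^2]
    ([taylor_remainder_lipschitz_gradient]).  By convexity the whole segment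
    [u_0 + t d_j], [0 <= t <= 1], lies in [Q]; along it, the slope of [f]
    differs from its initial value [<grad f (u_0), d_j>] by at most
    [L t |d_j|^2], by the Cauchy-Schwarz inequality and the Lipschitz
    hypothesis.  The mean value theorem applied to the slice of [f] corrected
    by the parabola [L t^2 |d_j|^2 / 2] turns this into the bound
    ([MVT_linear_remainder_le]).

    Hence [|e| <= L / 2 * |(|d_1|^2, ..., |d_n|^2)|], and the factor [|U^-1|]
    comes from [U^-T e] because a transposed matrix is bounded by the spectral
    norm of the matrix itself ([spectral_norm_trmx_mulmx]).

    All derivatives are relative to [Q], so the passage to one variable is
    made on first-order expansions valid on [Q] only: they hold on both sides
    of the interior points of the unit interval, where they give a derivative,
    and on one side at the endpoints, where they still give continuity. *)

Set Implicit Arguments.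
Unset Strict Implicit.
Unset Printing Implicit Defensive.

Import Order.TTheory GRing.Theory Num.Theory.

Local Open Scope classical_set_scope.
Local Open Scope ring_scope.

(** * Euclidean and spectral norms *)

(** Expanding [\sum_i (B * a i - c * b i) ^+ 2 >= 0], where [c] is the dot
    product and [A], [B] are the two sums of squares, gives
    [B * (A * B - c ^+ 2) >= 0]; one may divide by [B] unless [b] vanishes. *)
Lemma cauchy_schwarz_sum (R : realType) (I : finType) (a b : I -> R) :
  (\sum_i a i * b i) ^+ 2 <= (\sum_i a i ^+ 2) * (\sum_i b i ^+ 2).
Proof.
set c := \sum_i _; set A := \sum_i a i ^+ 2; set B := \sum_i b i ^+ 2.
have B_ge0 : 0 <= B by apply: sumr_ge0 => i _; exact: sqr_ge0.
have : 0 <= \sum_i (B * a i - c * b i) ^+ 2.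
  by apply: sumr_ge0 => i _; exact: sqr_ge0.
have -> : \sum_i (B * a i - c * b i) ^+ 2 = B * (A * B - c ^+ 2).
  transitivity (\sum_i (B ^+ 2 * a i ^+ 2 - 2 * B * c * (a i * b i)
                        + c ^+ 2 * b i ^+ 2)).
    by apply: eq_bigr => i _; ring.
  by rewrite !big_split/= sumrN -!mulr_sumr -/A -/B -/c; ring.
move: B_ge0; rewrite le_eqVlt => /predU1P[/esym B0 _|B_gt0]; last first.
  by rewrite pmulr_rge0// subr_ge0.
have b0 i : b i = 0.
  apply/eqP; rewrite -sqrf_eq0; apply/eqP.
  by apply: (psumr_eq0P _ B0) => // j _; exact: sqr_ge0.
rewrite B0 mulr0 /c big1 ?expr0n// => i _.
by rewrite b0 mulr0.
Qed.

Lemma enorm_ge0 (R : realType) m n (v : 'M[R]_(m, n)) : 0 <= enorm v.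
Proof. exact: sqrtr_ge0. Qed.

Lemma sqr_enorm (R : realType) m n (v : 'M[R]_(m, n)) :
  enorm v ^+ 2 = \sum_i \sum_j v i j ^+ 2.
Proof.
rewrite sqr_sqrtr//; apply: sumr_ge0 => i _; apply: sumr_ge0 => j _.
exact: sqr_ge0.
Qed.

Lemma sqr_enorm_col (R : realType) n (v : 'cV[R]_n) :
  enorm v ^+ 2 = \sum_i v i 0 ^+ 2.
Proof. by rewrite sqr_enorm; apply: eq_bigr => i _; rewrite big_ord1. Qed.

Lemma sqr_enorm_dot (R : realType) n (v : 'cV[R]_n) :
  enorm v ^+ 2 = (v^T *m v) 0 0.
Proof.
rewrite sqr_enorm_col mxE; apply: eq_bigr => i _.
by rewrite mxE expr2.
Qed.

Lemma enormZ (R : realType) m n (a : R) (v : 'M[R]_(m, n)) :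
  enorm (a *: v) = `|a| * enorm v.
Proof.
rewrite /enorm -sqrtr_sqr -sqrtrM ?sqr_ge0//; congr Num.sqrt.
rewrite mulr_sumr; apply: eq_bigr => i _.
by rewrite mulr_sumr; apply: eq_bigr => j _; rewrite mxE exprMn.
Qed.

Lemma enorm0 (R : realType) m n : enorm (0 : 'M[R]_(m, n)) = 0.
Proof. by rewrite -(scale0r 0) enormZ normr0 mul0r. Qed.

Lemma enorm_tr (R : realType) m n (v : 'M[R]_(m, n)) : enorm v^T = enorm v.
Proof.
rewrite /enorm exchange_big/=; congr Num.sqrt.
by do 2![apply: eq_bigr => ? _]; rewrite mxE.
Qed.

Lemma ler_enorm (R : realType) m n (v w : 'M[R]_(m, n)) :
  (forall i j, `|v i j| <= `|w i j|) -> enorm v <= enorm w.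
Proof.
move=> vw; rewrite ler_wsqrtr//; do 2![apply: ler_sum => ? _].
by rewrite -[leLHS]real_normK ?num_real// -[leRHS]real_normK ?num_real//
           ler_sqr ?nnegrE.
Qed.

Lemma cauchy_schwarz_enorm (R : realType) n (x y : 'cV[R]_n) :
  `|(x^T *m y) 0 0| <= enorm x * enorm y.
Proof.
rewrite -ler_sqr ?nnegrE ?mulr_ge0 ?enorm_ge0// real_normK ?num_real//.
rewrite exprMn !sqr_enorm_col mxE.
under eq_bigr do rewrite mxE.
exact: cauchy_schwarz_sum.
Qed.

(** The Frobenius norm of [A] bounds its spectral norm; this rough estimate
    makes the supremum that defines the spectral norm a finite one. *)
Lemma enorm_mulmx_le (R : realType) m n (A : 'M[R]_(m, n)) (x : 'cV[R]_n) :
  enorm (A *m x) <= enorm A * enorm x.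
Proof.
rewrite -ler_sqr ?nnegrE ?mulr_ge0 ?enorm_ge0// exprMn.
rewrite sqr_enorm_col (sqr_enorm A) mulr_suml; apply: ler_sum => i _.
by rewrite mxE sqr_enorm_col; exact: cauchy_schwarz_sum.
Qed.

Lemma enorm_eq0 (R : realType) n (x : 'cV[R]_n) : enorm x = 0 -> x = 0.
Proof.
move=> x0; have := sqr_enorm_col x; rewrite x0 expr0n/= => /esym s0.
apply/colP => i; apply/eqP; rewrite mxE -sqrf_eq0; apply/eqP.
by apply: (psumr_eq0P _ s0) => // j _; exact: sqr_ge0.
Qed.

Lemma spectral_norm_ub (R : realType) m n (A : 'M[R]_(m, n)) (x : 'cV[R]_n) :
  enorm x <= 1 -> enorm (A *m x) <= spectral_norm A.
Proof.
move=> x1; apply: ub_le_sup; last by exists x.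
exists (enorm A) => _ [y /= y1 <-].
by apply: le_trans (enorm_mulmx_le A y) _; rewrite ler_piMr ?enorm_ge0.
Qed.

Lemma spectral_norm_ge0 (R : realType) m n (A : 'M[R]_(m, n)) :
  0 <= spectral_norm A.
Proof.
apply: (le_trans (enorm_ge0 (A *m 0))); apply: spectral_norm_ub.
by rewrite enorm0 ler01.
Qed.

Lemma spectral_norm_mulmx (R : realType) m n (A : 'M[R]_(m, n)) (x : 'cV[R]_n) :
  enorm (A *m x) <= spectral_norm A * enorm x.
Proof.
have := enorm_ge0 x; rewrite le_eqVlt => /predU1P[/esym x0|x_gt0].
  by rewrite (enorm_eq0 x0) mulmx0 !enorm0 mulr0.
have xV : `|(enorm x)^-1| = (enorm x)^-1 by rewrite ger0_norm// invr_ge0 ltW.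
rewrite -ler_pdivrMr// mulrC -xV -enormZ scalemxAr.
by apply: spectral_norm_ub; rewrite enormZ xV mulVf ?gt_eqF.
Qed.

(** Moving one factor [A^T] across the dot product gives
    [|A^T x|^2 = <x, A (A^T x)> <= |x| * |A| * |A^T x|]. *)
Lemma spectral_norm_trmx_mulmx (R : realType) m n (A : 'M[R]_(m, n))
    (x : 'cV[R]_m) :
  enorm (A^T *m x) <= spectral_norm A * enorm x.
Proof.
have := enorm_ge0 (A^T *m x); rewrite le_eqVlt => /predU1P[<-|Ax_gt0].
  by rewrite mulr_ge0 ?enorm_ge0// spectral_norm_ge0.
rewrite -(ler_pM2r Ax_gt0) -expr2 sqr_enorm_dot trmx_mul trmxK -mulmxA.
apply: le_trans (ler_norm _) _; apply: le_trans (cauchy_schwarz_enorm _ _) _.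
rewrite -mulrA [leRHS]mulrCA.
by rewrite ler_wpM2l ?enorm_ge0// spectral_norm_mulmx.
Qed.

(** * Differentials relative to a set, restricted to a line *)

(** The differential along a filter is centered at the limit of that filter;
    this identifies the base point of a differential relative to [Q]. *)
Lemma lim_within (R : realType) (V : normedModType R) (Q : set V) (x : V) :
  Q x -> lim (within Q (nbhs x)) = x.
Proof.
move=> Qx.
have FF : ProperFilter (within Q (nbhs x)).
  by apply: within_nbhs_proper; exact: subset_closure.
apply: (@cvg_lim _ _ _ _ FF id x) => //.
by apply: cvg_within.
Qed.

Lemma differentiable_within_near (R : realType) (V W : normedModType R)
    (Q : set V) (f : V -> W) (x : V) :
  Q x -> differentiable f (within Q (nbhs x)) ->
  forall e, 0 < e -> \forall y \near x, Q y ->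
    `|f y - f x - 'd f (within Q (nbhs x)) (y - x)| <= e * `|y - x|.
Proof.
move=> Qx [[_ df]] e e_gt0.
have := (iffLR (eqaddoP _ _ _ _) df) e e_gt0.
rewrite near_withinE; apply: filterS => y + Qy => /(_ Qy).
rewrite lim_within//=.
by rewrite !fctE/= opprD addrA; apply.
Qed.

(** The expansion of [f] along a line, valid at the parameters whose point is
    in [Q].  It is stated with an explicit error instead of a derivative
    because at an end of the slice of [Q] only one side is available. *)
Lemma differentiable_within_line (R : realType) (V : normedModType R)
    (Q : set V) (f : V -> R) (x d : V) (t : R) :
  Q (x + t *: d) -> differentiable f (within Q (nbhs (x + t *: d))) ->
  forall e, 0 < e -> \forall s \near t, Q (x + s *: d) ->
    `|f (x + s *: d) - f (x + t *: d) -
      (s - t) * 'd f (within Q (nbhs (x + t *: d))) d| <= e * `|s - t|.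
Proof.
move=> Qx df e e_gt0.
(* Adding 1 keeps the denominator positive when [d] is zero. *)
have k_gt0 : 0 < `|d| + 1 by rewrite ltr_wpDl.
have ek_gt0 : 0 < e / (`|d| + 1) by rewrite divr_gt0.
have line_cvg : x + s *: d @[s --> t] --> x + t *: d.
  by apply: cvgD; [exact: cvg_cst|apply: cvgZr_tmp; exact: cvg_id].
move: (line_cvg _ (differentiable_within_near Qx df ek_gt0)); rewrite /nbhs/=.
apply: (@filterS _ (nbhs t)) => s /= + Qs => /(_ Qs).
have -> : x + s *: d - (x + t *: d) = (s - t) *: d.
  by rewrite opprD addrACA subrr add0r scalerBl.
rewrite linearZ => /le_trans; apply.
rewrite normrZ mulrCA [leRHS]mulrC ler_wpM2l//.
by rewrite -mulrA ger_pMr// ler_pdivrMl// mulr1 lerDl.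
Qed.

Lemma first_order_is_derive (R : realType) (p : R -> R) (t c : R) :
  (forall e, 0 < e -> \forall s \near t,
    `|p s - p t - (s - t) * c| <= e * `|s - t|) ->
  is_derive t 1 p c.
Proof.
move=> p_exp.
suff p_cvg : h^-1 *: ((p \o shift t) (h *: 1) - p t) @[h --> 0^'] --> c.
  split; first by apply/cvg_ex; exists c.
  exact: cvg_lim p_cvg.
apply/cvgrPdist_le => e e_gt0.
have shift_cvg : h *: (1 : R) + t @[h --> 0^'] --> t.
  rewrite -[X in _ --> X]add0r -[X in _ --> X + _](scale0r 1).
  by apply: cvgD; [apply: cvgZr_tmp; exact: nbhs_dnbhs|exact: cvg_cst].
have := shift_cvg _ (p_exp e e_gt0); rewrite /nbhs/= => p_near.
near=> h.
have h_neq0 : h != 0 by near: h; exact: nbhs_dnbhs_neq.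
have : `|p (h *: 1 + t) - p t - (h *: 1 + t - t) * c| <= e * `|h *: 1 + t - t|.
  by near: h.
rewrite /= addrK /GRing.scale/= mulr1 distrC => p_le.
rewrite -(ler_pM2r (_ : 0 < `|h|)) ?normr_gt0// -normrM.
by rewrite mulrBl mulrAC mulVf// mul1r distrC [c * h]mulrC distrC.
Unshelve. all: by end_near. Qed.

(** The expansion is required only on the trace of [A], so endpoints of an
    interval are covered. *)
Lemma first_order_continuous_within (R : realType) (A : set R) (p : R -> R)
    (c : R -> R) :
  (forall t, A t -> \forall s \near t, A s ->
    `|p s - p t - (s - t) * c t| <= `|s - t|) ->
  {within A, continuous p}.
Proof.
move=> p_exp; apply/subspace_continuousP => t At.
apply/cvgrPdist_le => e e_gt0; rewrite near_withinE.
have k_gt0 : 0 < 1 + `|c t| by rewrite ltr_pwDl.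
have s_near : \forall s \near t, `|t - s| <= e / (1 + `|c t|).
  by apply: (@cvgr_dist_le _ _ _ (nbhs t) _ id t) => //; exact: divr_gt0.
near=> s => As.
have s_le : `|t - s| <= e / (1 + `|c t|) by near: s.
have ps_le : `|p s - p t - (s - t) * c t| <= `|s - t|.
  by have := As; near: s; exact: p_exp.
rewrite distrC -[p s - p t](subrK ((s - t) * c t)).
apply: le_trans (ler_normD _ _) _; rewrite normrM.
apply: le_trans (lerD ps_le (lexx _)) _.
by rewrite -{1}[`|s - t|]mulr1 -mulrDr distrC -ler_pdivlMr.
Unshelve. all: by end_near. Qed.

(** * Taylor's bound for a Lipschitz gradient *)

(** The mean value theorem for [p] itself would only give [K] as a bound.
    Subtracting [a * t + s * (K / 2) * t ^+ 2] first leaves a function whose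
    derivative is nonpositive for [s = 1] and nonnegative for [s = -1], so the
    signs of its increment over the unit interval give both sides of the
    bound, with the factor [1 / 2] of the parabola. *)
Lemma MVT_linear_remainder_le (R : realType) (p dp : R -> R) (a K : R) :
  {within `[0, 1], continuous p} ->
  (forall t : R, t \in `]0, 1[ -> is_derive t 1 p (dp t)) ->
  (forall t : R, t \in `]0, 1[ -> `|dp t - a| <= K * t) ->
  `|p 1 - p 0 - a| <= K / 2.
Proof.
move=> p_cont p_der dp_le.
have aux (s : R) : exists2 c, c \in `]0, 1[ &
    p 1 - p 0 - a - s * (K / 2) = dp c - a - s * (K * c).
  pose q t := p t - (a * t + s * (K / 2) * t ^+ 2).
  have q_der (t : R) : t \in `]0, 1[ -> is_derive t 1 q (dp t - a - s * (K * t)).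
    move=> t01; have ? := p_der t t01.
    rewrite /q; apply: is_derive_eq.
    by rewrite /GRing.scale/=; field.
  have q_cont : {within `[0, 1], continuous q}.
    have r_cont : {within `[0, 1],
        continuous (fun t : R => a * t + s * (K / 2) * t ^+ 2)}.
      apply: continuous_subspaceT => x.
      apply: differentiable_continuous; apply/derivable1_diffP.
      by apply: ex_derive.
    by move=> t; exact: continuousB (p_cont t) (r_cont t).
  have [c c01 qc] := MVT ltr01 q_der q_cont.
  by exists c => //; move: qc; rewrite subr0 mulr1 => <-; rewrite /q; field.
rewrite ler_norml; apply/andP; split.
  have [c c01 ec] := aux (-1).
  have := dp_le c c01; rewrite ler_norml => /andP[]; lra.
have [c c01 ec] := aux 1.
have := dp_le c c01; rewrite ler_norml => /andP[]; lra.
Qed.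

(** Only the linearity of the differential matters, so this also holds when
    [Q] has empty interior and the differential relative to [Q] is merely one
    choice among several. *)
Lemma gradient_dot (R : realType) n (Q : set 'cV[R]_n) (f : 'cV[R]_n -> R)
    (x d : 'cV[R]_n) :
  ((gradient Q f x)^T *m d) 0 0 = 'd f (within Q (nbhs x)) d.
Proof.
rewrite [in RHS](matrix_sum_delta d) linear_sum mxE; apply: eq_bigr => i _.
by rewrite big_ord1 linearZ !mxE mulrC.
Qed.

Lemma dotBl (R : realType) n (x y d : 'cV[R]_n) :
  (x^T *m d) 0 0 - (y^T *m d) 0 0 = ((x - y)^T *m d) 0 0.
Proof.
by rewrite !mxE -sumrB; apply: eq_bigr => i _; rewrite !mxE mulrBl.
Qed.

Lemma convex_set_segment (R : realType) n (Q : set 'cV[R]_n) (a b : 'cV[R]_n)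
    (t : R) :
  convex_set Q -> Q a -> Q b -> 0 <= t <= 1 -> Q (a + t *: (b - a)).
Proof.
move=> Q_convex Qa Qb /andP[t0 t1].
have := Q_convex b a (Itv01 t0 t1); rewrite !inE => /(_ Qb Qa).
rewrite /conv/= scalerBl scale1r scalerBr.
by rewrite addrCA.
Qed.

(** Along the segment from [a] to [b] the slope of [f] drifts from its value
    at [a] by at most [(L * enorm (b - a) ^+ 2) * t], which is the growth that
    [MVT_linear_remainder_le] integrates. *)
Lemma taylor_remainder_lipschitz_gradient (R : realType) n
    (Q : set 'cV[R]_n) (f : 'cV[R]_n -> R) (L : R) (a b : 'cV[R]_n) :
  convex_set Q ->
  (forall x, Q x -> differentiable f (within Q (nbhs x))) ->
  euclidean_lipschitz_on Q L (gradient Q f) -> Q a -> Q b ->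
  `|f b - f a - ((gradient Q f a)^T *m (b - a)) 0 0|
    <= L / 2 * enorm (b - a) ^+ 2.
Proof.
move=> Q_convex f_diff f_lip Qa Qb; set d := b - a.
pose p t := f (a + t *: d).
pose dp t := ((gradient Q f (a + t *: d))^T *m d) 0 0.
have Qline (t : R) : 0 <= t <= 1 -> Q (a + t *: d).
  exact: convex_set_segment.
have p_exp (t : R) : 0 <= t <= 1 -> forall e, 0 < e -> \forall s \near t,
    0 <= s <= 1 -> `|p s - p t - (s - t) * dp t| <= e * `|s - t|.
  move=> t01 e e_gt0; rewrite /dp gradient_dot.
  have := differentiable_within_line (Qline _ t01) (f_diff _ (Qline _ t01)) e_gt0.
  by apply: filterS => s /= + s01; apply; exact: Qline.
have -> : f b = p 1 by rewrite /p scale1r addrC subrK.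
have -> : f a = p 0 by rewrite /p scale0r addr0.
rewrite mulrAC; apply: (MVT_linear_remainder_le (dp := dp)).
- apply: (@first_order_continuous_within _ _ _ dp) => t; rewrite /= in_itv/= => t01.
  have := p_exp t t01 1 ltr01.
  by apply: filterS => s + s01; rewrite /= in_itv/= mul1r in s01 *; apply.
- move=> t t01; apply: first_order_is_derive => e e_gt0.
  have := near_in_itvoo t01.
  have t01' : 0 <= t <= 1.
    by move: t01; rewrite in_itv/= => /andP[/ltW -> /ltW ->].
  apply: filterS2 (p_exp t t01' e e_gt0) => s + s01; apply.
  by move: s01; rewrite in_itv/= => /andP[/ltW -> /ltW ->].
move=> t; rewrite in_itv/= => /andP[t0 t1].
have Qt : Q (a + t *: d) by apply: Qline; rewrite !ltW.
rewrite /dp dotBl.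
apply: le_trans (cauchy_schwarz_enorm _ _) _.
have := f_lip _ _ Qt Qa; rewrite [a + _]addrC addrK enormZ gtr0_norm// => gt_le.
apply: le_trans (ler_wpM2r (enorm_ge0 _) gt_le) _.
by rewrite le_eqVlt; apply/orP; left; apply/eqP; ring.
Qed.

(** * The error of the simplex gradient *)

Theorem theorem4 (R : realType) (n : nat) (n_ge1 : (1 <= n)%N)
    (Q : set 'cV[R]_n) (Q_convex : convex_set Q)
    (f : 'cV[R]_n -> R) (f_C2 : twice_continuously_differentiable_on Q f)
    (L : R) (L_ge0 : 0 <= L)
    (f_lip : euclidean_lipschitz_on Q L (gradient Q f))
    (u : 'I_n.+1 -> 'cV[R]_n) (u_in_Q : forall k, Q (u k))
    (U_nonsingular : simplex_matrix u \in unitmx) :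
  enorm (simplex_gradient f u - gradient Q f (u ord0)) <=
  L / 2 *
  enorm (\row_j ((displacement u j)^T *m displacement u j) 0 0) *
  spectral_norm (invmx (simplex_matrix u)).
Proof.
have [f_diff _ _] := f_C2.
set U := simplex_matrix u; set g := gradient Q f (u ord0).
set df := (\row_j (f (u (lift ord0 j)) - f (u ord0)))^T.
have -> : simplex_gradient f u - g = (invmx U)^T *m (df - U^T *m g).
  have UV : (invmx U)^T *m U^T = 1%:M by rewrite -trmx_mul mulmxV// trmx1.
  by rewrite mulmxBr mulmxA UV mul1mx.
apply: le_trans (spectral_norm_trmx_mulmx _ _) _.
rewrite mulrC ler_wpM2r ?spectral_norm_ge0//.
rewrite -[L / 2]ger0_norm ?divr_ge0// -enormZ -[leRHS]enorm_tr.
apply: ler_enorm => j k; rewrite ord1 {k}.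
have -> : (df - U^T *m g) j 0 = f (u (lift ord0 j)) - f (u ord0) -
    (g^T *m displacement u j) 0 0.
  (* Testing against a basis vector reads off the [j]-th entry without
     unfolding the gradient itself. *)
  have -> : g^T *m displacement u j = (U^T *m g)^T *m delta_mx j 0.
    rewrite trmx_mul trmxK -mulmxA; congr (_ *m _).
    by apply/colP => i; rewrite -colE !mxE.
  by rewrite -colE; move: (U^T *m g) => w; rewrite !mxE.
have -> : (L / 2 *: \row_i ((displacement u i)^T *m displacement u i) 0 0)^T j 0
    = L / 2 * enorm (displacement u j) ^+ 2.
  by rewrite sqr_enorm_dot !mxE.
rewrite [leRHS]ger0_norm ?mulr_ge0 ?divr_ge0 ?enorm_ge0//.
exact: taylor_remainder_lipschitz_gradient.
Qed.
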